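(* The decision problem \textsc{Reformability}, restricted to instances with identical binary utilities (the number of agents being part of the input), is in P.
   Context: Let $N=\{1,\dots,n\}$ be a set of $n\ge 2$ agents and $M$ a set of $m\ge 1$ indivisible goods. Each agent $i$ has an additive utility function $u_i:2^M\to\mathbb{R}_{\ge 0}$, i.e., $u_i(M')=\sum_{g\in M'}u_i(\{g\})$. An instance consists of $N$, $M$ and $(u_i)_{i\in N}$. Utilities are identical if $u_i=u_j$ for all $i,j\in N$, and binary if $u_i(\{g\})\in\{0,1\}$ for all $i\in N$, $g\in M$. An allocation $\mathcal{A}=(A_1,\dots,A_n)$ is an ordered partition of $M$ into $n$ (possibly empty) bundles, $A_i$ going to agent $i$. A size vector is $\vec{s}=(s_1,\dots,s_n)$ with non-negative integer entries and $\sum_i s_i=m$; $\mathcal{A}$ has size vector $\vec{s}$ if $|A_i|=s_i$ for all $i$. Agent $i$ is EF1 towards agent $j$ in $\mathcal{A}$ if $A_j=\varnothing$ or there exists $g\in A_j$ with $u_i(A_i)\ge u_i(A_j\setminus\{g\})$. $\mathcal{A}$ is EF1 if every agent is EF1 towards every other agent. \textsc{Reformability}: given an instance (utilities listed good by good for each agent) and a size vector $\vec{s}$, decide whether there exists an EF1 allocation with size vector $\vec{s}$. *)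

(* Defs.v *)
From Corelib Require Import BinNums.
From HB Require Import structures.
From mathcomp Require Import all_boot all_order all_algebra.
Set Implicit Arguments.
Unset Strict Implicit.
Unset Printing Implicit Defensive.
Import Order.TTheory GRing.Theory Num.Theory.

(** ** Turing machines and the class P *)

Definition language (Sigma : finType) := seq Sigma -> Prop.

Inductive direction := ToLeft | Stay | ToRight.

(* A two-way infinite tape: [tleft] lists the cells left of the head from
   right to left, [tright] the cells right of it from left to right; all cells
   beyond these lists are blank. *)
Record tape (G : Type) := Tape { tleft : seq G; thead : G; tright : seq G }.

Definition tape_write (G : Type) (a : G) (t : tape G) : tape G :=
  Tape (tleft t) a (tright t).

Definition tape_move (G : Type) (blank : G) (d : direction) (t : tape G) :
    tape G :=
  match d with
  | ToLeft => Tape (behead (tleft t)) (head blank (tleft t))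
                   (thead t :: tright t)
  | Stay => t
  | ToRight => Tape (thead t :: tleft t) (head blank (tright t))
                    (behead (tright t))
  end.

(* Deterministic machine with [tm_work.+1] tapes. [None] is the blank,
   [Some (inl a)] an input symbol and [Some (inr x)] a further tape symbol.
   [tm_verdict q] is [Some true] if q is an accepting halting state,
   [Some false] if it is a rejecting one, [None] if q is not halting. *)
Record turing_machine (Sigma : finType) := TuringMachine {
  tm_work : nat;
  tm_extra : finType;
  tm_state : finType;
  tm_start : tm_state;
  tm_verdict : tm_state -> option bool;
  tm_delta : tm_state -> (tm_work.+1).-tuple (option (Sigma + tm_extra)) ->
    tm_state * (tm_work.+1).-tuple (option (Sigma + tm_extra) * direction)
}.

Section Runs.
Variables (Sigma : finType) (M : turing_machine Sigma).

Definition tape_symbol := option (Sigma + tm_extra M).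

Record config := Config {
  cstate : tm_state M;
  ctapes : ((tm_work M).+1).-tuple (tape tape_symbol)
}.

Definition input_tape (w : seq Sigma) : tape tape_symbol :=
  let s : seq tape_symbol := [seq Some (inl a) | a <- w] in
  Tape [::] (head None s) (behead s).

Definition blank_tape : tape tape_symbol := Tape [::] None [::].

Definition initial (w : seq Sigma) : config :=
  Config (tm_start M) [tuple of input_tape w :: nseq (tm_work M) blank_tape].

(* Halting configurations are fixed points. *)
Definition step (c : config) : config :=
  if tm_verdict (cstate c) is Some _ then c else
  let: (q, acts) :=
    tm_delta (cstate c) [tuple of [seq thead t | t <- ctapes c]] in
  Config q [tuple of [seq tape_move None at_.1.2 (tape_write at_.1.1 at_.2)
                     | at_ <- zip acts (ctapes c)]].

Definition verdict_after (t : nat) (w : seq Sigma) : option bool :=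
  tm_verdict (cstate (iter t step (initial w))).

Definition decides_in_time (T : nat -> nat) (L : language Sigma) : Prop :=
  forall w, exists2 b : bool, verdict_after (T (size w)) w = Some b & b <-> L w.

End Runs.

Definition in_P (Sigma : finType) (L : language Sigma) : Prop :=
  exists (M : turing_machine Sigma) (c k : nat),
    decides_in_time M (fun l => c * l ^ k + c)%N L.

(** ** Fair division of indivisible goods *)

Section FairDivision.
Local Open Scope ring_scope.

Record instance (R : realDomainType) := Instance {
  agents : nat;
  goods : nat;
  agents_ge2 : (2 <= agents)%N;
  goods_ge1 : (1 <= goods)%N;
  utility : 'I_agents -> {set 'I_goods} -> R;
  utility_ge0 : forall i B, 0 <= utility i B;
  utility_additive :
    forall i B, utility i B = \sum_(g in B) utility i [set g]
}.

Variables (R : realDomainType) (I : instance R).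

Definition identical_utilities : Prop :=
  forall i j : 'I_(agents I), utility i =1 utility j.

Definition binary_utilities : Prop :=
  forall (i : 'I_(agents I)) (g : 'I_(goods I)),
    utility i [set g] = 0 \/ utility i [set g] = 1.

Definition bundles := 'I_(agents I) -> {set 'I_(goods I)}.

Definition is_allocation (A : bundles) : Prop :=
  (forall i j, i != j -> [disjoint A i & A j]) /\ \bigcup_i A i = [set: _].

Definition is_size_vector (s : 'I_(agents I) -> nat) : Prop :=
  (\sum_i s i)%N = goods I.

Definition has_size_vector (A : bundles) (s : 'I_(agents I) -> nat) : Prop :=
  forall i, #|A i| = s i.

Definition EF1_towards (A : bundles) (i j : 'I_(agents I)) : Prop :=
  A j = set0 \/
  exists2 g, g \in A j & utility i (A i) >= utility i (A j :\ g).

Definition EF1 (A : bundles) : Prop :=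
  forall i j, i != j -> EF1_towards A i j.

Definition reformable (s : 'I_(agents I) -> nat) : Prop :=
  exists A : bundles, [/\ is_allocation A, has_size_vector A s & EF1 A].

End FairDivision.

(** ** Reformability as a language *)

Inductive symbol := Bit of bool | Slash | Comma | Semicolon.

Definition symbol_code (x : symbol) : option (option (option bool)) :=
  match x with
  | Bit b => Some (Some (Some b))
  | Slash => Some (Some None)
  | Comma => Some None
  | Semicolon => None
  end.

Definition symbol_decode (x : option (option (option bool))) : symbol :=
  match x with
  | Some (Some (Some b)) => Bit b
  | Some (Some None) => Slash
  | Some None => Comma
  | None => Semicolon
  end.

Lemma symbol_codeK : cancel symbol_code symbol_decode.
Proof. by case. Qed.

HB.instance Definition _ := Finite.copy symbol (can_type symbol_codeK).

(* Binary numerals, most significant bit first, without leading zeros; the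
   numeral of 0 is the single bit 0. *)
Fixpoint encode_pos (p : positive) : seq symbol :=
  match p with
  | xH => [:: Bit true]
  | xO p' => rcons (encode_pos p') (Bit false)
  | xI p' => rcons (encode_pos p') (Bit true)
  end.

Definition encode_nat (n : nat) : seq symbol :=
  if bin_of_nat n is Npos p then encode_pos p else [:: Bit false].

(* Only used for q >= 0, so the sign is not recorded. *)
Definition encode_rat (q : rat) : seq symbol :=
  encode_nat `|numq q|%N ++ Slash :: encode_nat `|denq q|%N.

(* The utilities, agent by agent and good by good, then the size vector. *)
Definition encode (I : instance rat) (s : 'I_(agents I) -> nat) : seq symbol :=
  flatten [seq rcons (flatten [seq rcons (encode_rat (utility i [set g])) Comma
                              | g <- enum 'I_(goods I)]) Semicolon
          | i <- enum 'I_(agents I)]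
  ++ flatten [seq rcons (encode_nat (s i)) Comma | i <- enum 'I_(agents I)].

(* The set of (encodings of) yes-instances of Reformability within a class C
   of instances. A machine deciding it also rejects all strings that do not
   encode an instance in C together with a size vector. *)
Definition Reformability (C : instance rat -> Prop) : language symbol :=
  fun w => exists (I : instance rat) (s : 'I_(agents I) -> nat),
    [/\ C I, is_size_vector s, w = encode s & reformable s].

Definition identical_binary (I : instance rat) : Prop :=
  identical_utilities I /\ binary_utilities I.

(* Main.v *)
From HB Require Import structures.
From mathcomp Require Import all_boot all_order all_algebra.
From mathcomp Require Import zify.
Require Import Defs.

(* With identical binary utilities only the numbers a_i of valuable goods in the
   bundles matter, and EF1 says that any two of them differ by at most 1. If
   there are k valuable goods, q = k / n and r = k mod n, then r of the a_i are
   q+1 and the others are q, so that an EF1 allocation with sizes s_i exists iff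
   s_i >= q for all i and at least r of the s_i exceed q.

   The machine decides this in one pass over the input. Besides the input tape
   it has a tape holding the first row, against which the other rows are
   compared, and seven unary counters; division is repeated subtraction. A
   binary size v is turned into unary by doubling, and every unit of v is
   charged at once to the number of goods not yet allotted, so that v never
   exceeds m and each input symbol costs linear time. *)

Set Implicit Arguments.
Unset Strict Implicit.
Unset Printing Implicit Defensive.

(** * The machine *)

Inductive state :=
  | Start | FirstEntry | FirstSlash | One of bool | Sep of bool | Rewind
  | Entry of bool | EntrySlash of bool
  | Div | DivNext | DivLast
  | Digit | Double | Undouble | UndoubleAgain
  | Compare | Restore | Clear | NextSize | Size
  | Halt of bool.

Definition states : seq state :=
  [:: Start; FirstEntry; FirstSlash; One true; One false; Sep true; Sep false;
      Rewind; Entry true; Entry false; EntrySlash true; EntrySlash false;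
      Div; DivNext; DivLast; Digit; Double; Undouble; UndoubleAgain;
      Compare; Restore; Clear; NextSize; Size; Halt true; Halt false].

Definition state_index (q : state) : nat :=
  match q with
  | Start => 0 | FirstEntry => 1 | FirstSlash => 2
  | One b => if b then 3 else 4 | Sep b => if b then 5 else 6
  | Rewind => 7 | Entry b => if b then 8 else 9
  | EntrySlash b => if b then 10 else 11
  | Div => 12 | DivNext => 13 | DivLast => 14 | Digit => 15 | Double => 16
  | Undouble => 17 | UndoubleAgain => 18 | Compare => 19 | Restore => 20
  | Clear => 21 | NextSize => 22 | Size => 23 | Halt b => if b then 24 else 25
  end.

Lemma state_indexK : cancel state_index (nth Start states).
Proof. by do ![case]. Qed.

HB.instance Definition _ := Countable.copy state (can_type state_indexK).

Lemma statesP : Finite.axiom states.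
Proof. by do ![case]. Qed.

HB.instance Definition _ := isFinite.Build state statesP.

Definition cell : Type := option (symbol + unit).
Definition mark : cell := Some (inr tt).
Definition bit_cell (b : bool) : cell := Some (inl (Bit b)).

(* The roles of the counters, with reuse across phases:
   K: valuable goods of the first row, used up by the division, then the part of
      Q already compared with V;
   N: rows after the first, then agents, then sizes still expected;
   T: scratch; M: goods not yet allotted; Q, R: quotient and remainder of K by
   N, R being decremented for every size above Q; V: current bit or size. *)
Inductive counter := cK | cN | cT | cM | cQ | cR | cV.

Definition eq_counter (c d : counter) : bool :=
  match c, d with
  | cK, cK | cN, cN | cT, cT | cM, cM | cQ, cQ | cR, cR | cV, cV => true
  | _, _ => false
  end.

Definition by_counter (A : Type) (k n t m p r v : A) (c : counter) : A :=
  match c with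
  | cK => k | cN => n | cT => t | cM => m | cQ => p | cR => r | cV => v
  end.

Record instr := Instr {
  next : state;
  advance : bool;
  row_write : option bool;
  row_move : direction;
  incs : seq counter;
  decs : seq counter
}.

Definition goto (q : state) : instr := Instr q false None Stay [::] [::].
Definition skip (q : state) : instr := Instr q true None Stay [::] [::].
Definition count_to (q : state) (up down : seq counter) : instr :=
  Instr q false None Stay up down.
Definition skip_count (q : state) (up down : seq counter) : instr :=
  Instr q true None Stay up down.
Definition reject : instr := goto (Halt false).

(** [x] and [y] are the cells under the input and row heads; [pos] tells which counters are
    positive. [One] and [Sep] read the denominator 1 and the comma of an entry, their flag marking
    the first row. When [EntrySlash] finds no slash, the bit before it was the first digit of the
    first size: N is then raised from the number of rows after the first to the number of agents,
    and the bit is charged to M. *)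
Definition control (q : state) (x y : cell) (pos : counter -> bool) : instr :=
  match q with
  | Start | Halt _ => reject
  | FirstEntry =>
      match x with
      | Some (inl (Bit b)) =>
          Instr FirstSlash true (Some b) ToRight
            (if b then [:: cM; cK] else [:: cM]) [::]
      | Some (inl Semicolon) => if pos cM then skip Rewind else reject
      | _ => reject
      end
  | FirstSlash => if x is Some (inl Slash) then skip (One true) else reject
  | One first => if x is Some (inl (Bit true)) then skip (Sep first) else reject
  | Sep first =>
      if x is Some (inl Comma) then
        skip (if first then FirstEntry else Entry false)
      else reject
  | Rewind =>
      if y is Some (inr _) then Instr (Entry true) false None ToRight [::] [::]
      else Instr Rewind false None ToLeft [::] [::]
  | Entry fresh =>
      match x with
      | Some (inl (Bit b)) =>
          skip_count (EntrySlash fresh) (if b then [:: cV] else [::]) [::]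
      | Some (inl Semicolon) =>
          if fresh then reject
          else if y is None then skip_count Rewind [:: cN] [::] else reject
      | _ => reject
      end
  | EntrySlash fresh =>
      match x with
      | Some (inl Slash) =>
          if y is Some (inl (Bit c)) then
            if c == pos cV then
              Instr (One false) true None ToRight [::] [:: cV]
            else reject
          else reject
      | _ =>
          if fresh then
            if pos cN then
              count_to Div [:: cN] (if pos cV then [:: cM] else [::])
            else reject
          else reject
      end
  | Div =>
      if pos cN then
        if pos cK then count_to Div [:: cT] [:: cN; cK] else goto DivLast
      else count_to DivNext [:: cQ] [::]
  | DivNext => if pos cT then count_to DivNext [:: cN] [:: cT] else goto Div
  | DivLast =>
      if pos cT then count_to DivLast [:: cN; cR] [:: cT] else goto Digit
  | Digit =>
      match x with
      | Some (inl (Bit _)) => if pos cV then goto Double else reject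
      | Some (inl Comma) => skip Compare
      | _ => reject
      end
  | Double =>
      if pos cV then
        if pos cM then count_to Double [:: cT] [:: cV; cM] else reject
      else goto Undouble
  | Undouble =>
      if pos cT then count_to UndoubleAgain [:: cV] [:: cT]
      else match x with
      | Some (inl (Bit true)) =>
          if pos cM then skip_count Digit [:: cV] [:: cM] else reject
      | _ => skip Digit
      end
  | UndoubleAgain => count_to Undouble [:: cV] [::]
  | Compare =>
      if pos cQ then
        if pos cV then count_to Compare [:: cK] [:: cQ; cV] else reject
      else count_to Restore [::] (if pos cV then [:: cR] else [::])
  | Restore => if pos cK then count_to Restore [:: cQ] [:: cK] else goto Clear
  | Clear => if pos cV then count_to Clear [::] [:: cV] else goto NextSize
  | NextSize => if pos cN then count_to Size [::] [:: cN] else reject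
  | Size =>
      match x with
      | None => if pos cN || pos cM || pos cR then reject else goto (Halt true)
      | Some (inl (Bit true)) =>
          if pos cM then skip_count Digit [:: cV] [:: cM] else reject
      | Some (inl (Bit false)) => skip Digit
      | _ => reject
      end
  end.

Definition verdict (q : state) : option bool :=
  if q is Halt b then Some b else None.

Definition apply_row (i : instr) (y : cell) : cell * direction :=
  (if row_write i is Some b then bit_cell b else y, row_move i).

Definition is_pos (n : nat) : bool := if n is _.+1 then true else false.

Definition is_mark (y : cell) : bool := if y is Some (inr _) then true else false.

Definition counter_dir (i : instr) (c : counter) (pos : bool) : direction :=
  if has (eq_counter c) (incs i) then ToRight
  else if has (eq_counter c) (decs i) && pos then ToLeft else Stay.

Definition update (i : instr) (c : counter) (n : nat) : nat :=
  if has (eq_counter c) (incs i) then n.+1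
  else if has (eq_counter c) (decs i) then n.-1 else n.

(** * Simulation of the tapes by natural numbers *)

Record conf := Conf {
  cf_state : state;
  cf_input : seq symbol;
  cf_row : tape cell;
  cf_K : nat; cf_N : nat; cf_T : nat; cf_M : nat; cf_Q : nat; cf_R : nat;
  cf_V : nat
}.

Definition read (w : seq symbol) : cell :=
  if w is x :: _ then Some (inl x) else None.

Definition cstep (c : conf) : conf :=
  let: Conf q w y k n t m p r v := c in
  if verdict q is Some _ then c else
  let i := control q (read w) (thead y)
    (fun c => is_pos (by_counter k n t m p r v c)) in
  Conf (next i) (if advance i then behead w else w)
    (tape_move None (row_move i)
      (if row_write i is Some b then tape_write (bit_cell b) y else y))
    (update i cK k) (update i cN n) (update i cT t) (update i cM m)
    (update i cQ p) (update i cR r) (update i cV v).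

(** Taking a sequence lets one pattern name the nine cells. The [Start] transition puts down the
    marks on the row tape and on the counters, so the simulation begins one step later. *)
Definition tm_control_seq (q : state) (xs : seq cell) :
    state * 9.-tuple (cell * direction) :=
  if q is Start then
    (FirstEntry, [tuple of [:: (nth None xs 0, Stay), (mark, ToRight)
                             & nseq 7 (mark, Stay)]])
  else if xs is [:: x; y; k; n; t; m; p; r; v] then
    let i := control q x y (fun c => ~~ is_mark (by_counter k n t m p r v c)) in
    let d c z := (z, counter_dir i c (~~ is_mark z)) in
    (next i, [tuple (x, if advance i then ToRight else Stay); apply_row i y;
       d cK k; d cN n; d cT t; d cM m; d cQ p; d cR r; d cV v])
  else (q, [tuple of nseq 9 (None, Stay)]).

Definition tm_control (q : state) (xs : 9.-tuple cell) :=
  tm_control_seq q xs.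

Definition reform_tm : turing_machine symbol :=
  @TuringMachine symbol 8 unit state Start verdict tm_control.

(* A counter is a tape that is blank except for a mark; its value is the
   distance of the head to the right of the mark. *)
Definition counter_tape (t : tape cell) (n : nat) : Prop :=
  exists j, t = if n is n'.+1 then
                  Tape (rcons (nseq n' None) mark) None (nseq j None)
                else Tape [::] mark (nseq j None).

Lemma counter_tape_mark t n : counter_tape t n -> is_pos n = ~~ is_mark (thead t).
Proof. by case=> j ->; case: n. Qed.

(** Decrements are truncated on both sides: at 0 the head stays on the mark, and [.-1] fixes 0. The
    number [j] of stored blanks varies, because a move to the left leaves a blank on the right. *)
Lemma counter_tape_step i c t n : counter_tape t n ->
  counter_tape (tape_move None (counter_dir i c (~~ is_mark (thead t)))
                 (tape_write (thead t) t)) (update i c n).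
Proof.
move=> tn; rewrite -(counter_tape_mark tn) /counter_dir /update.
case: tn => j ->; case: ifP => _.
  by case: n => [|n]; exists j.-1; case: j.
case: has => /=; last by exists j; case: n.
case: n => [|[|n]] /=; first by exists j.
  by exists j.+1.
by exists j.+1.
Qed.

Lemma eq_control q x y pos pos' : pos =1 pos' ->
  control q x y pos = control q x y pos'.
Proof. by move=> e; case: q => [||||||||||||||||||||] * /=; rewrite ?e. Qed.

(** The cells [l] left of the input head are arbitrary, since that head never moves left. [Start] is
    excluded because its transition is not given by [control]. *)
Definition simulates (c : config reform_tm) (a : conf) : Prop :=
  let: Conf q w y k n t m p r v := a in
  q = cstate c /\ q <> Start /\
  exists l tk tn tt tm tp tr tv,
  [/\ tval (ctapes c) =
        [:: Tape l (read w) [seq Some (inl x) | x <- behead w]; y;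
            tk; tn; tt; tm; tp; tr; tv],
      counter_tape tk k, counter_tape tn n & counter_tape tt t] /\
  [/\ counter_tape tm m, counter_tape tp p, counter_tape tr r
    & counter_tape tv v].

Lemma control_Start q x y pos : next (control q x y pos) <> Start.
Proof.
case: q => [||||||||||||||||||||] * /=;
  do ?[case: ifP => _ //|case: x => [[[]|]|] * //|case: y => [[[]|]|] * //];
  by repeat match goal with
    |- context [match ?b with _ => _ end] => case: b => * end.
Qed.

Lemma simulates_step c a : simulates c a -> simulates (step c) (cstep a).
Proof.
case: a => q w y k n t m p r v; case: c => q' ts [/= <- {q'}] [qS].
case=> l [tk] [tn] [tt] [tm] [tp] [tr] [tv] [] [tsE Hk Hn Ht] [Hm Hp Hr Hv].
rewrite /step /=; case vq: (verdict q) => [b|].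
  by do 2![split=> //]; exists l, tk, tn, tt, tm, tp, tr, tv.
set i := control _ _ _ _.
have delta : tm_control_seq q [seq thead u | u <- ts] =
    let d c z := (z, counter_dir i c (~~ is_mark z)) in
    (next i, [tuple (read w, if advance i then ToRight else Stay);
       apply_row i (thead y);
       d cK (thead tk); d cN (thead tn); d cT (thead tt); d cM (thead tm);
       d cQ (thead tp); d cR (thead tr); d cV (thead tv)]).
  rewrite tsE /tm_control_seq /=; set i' := control _ _ _ _.
  have -> : i' = i.
    by apply: eq_control => -[] /=; symmetry; apply: counter_tape_mark.
  by case: (q) qS.
rewrite /tm_control /= delta /=; split=> //; split; first exact: control_Start.
exists (if advance i then read w :: l else l).
do 7![eexists]; split; split.
- rewrite tsE /=; congr [:: _, _ & _].
    by case: (advance i) => //=; case: (w) => [|x [|x' w']].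
  by case: (row_write i) => //; case: (y).
all: exact: counter_tape_step.
Qed.

Lemma simulates_start w :
  simulates (step (initial reform_tm w))
    (Conf FirstEntry w (Tape [:: mark] None [::]) 0 0 0 0 0 0 0).
Proof.
split=> //; split=> //; exists [::]; do 7![eexists]; split; split.
- by rewrite /=; case: w.
all: by exists 0.
Qed.

(** Halting configurations are fixed points, so this means halting within at most [t] steps, and
    only upper bounds need to be tracked. *)
Definition halts (t : nat) (a : conf) (b : bool) : Prop :=
  verdict (cf_state (iter t cstep a)) = Some b.

Lemma simulates_verdict t c a : simulates c a ->
  tm_verdict (cstate (iter t (@step _ reform_tm) c)) =
  verdict (cf_state (iter t cstep a)).
Proof.
elim: t c a => [|t IH] c a ca; first by case: a ca => ? ? ? ? ? ? ? ? ? ? [->].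
by rewrite !iterSr; apply/IH/simulates_step.
Qed.

Lemma halts_verdict_after t w b :
  halts t (Conf FirstEntry w (Tape [:: mark] None [::]) 0 0 0 0 0 0 0) b ->
  verdict_after reform_tm t.+1 w = Some b.
Proof.
by rewrite /verdict_after iterSr (simulates_verdict _ (simulates_start w)).
Qed.

(** * Running time *)

(* [v] is the value of the numeral read so far, [None] between numerals; it has
   already been deducted from [M]. *)
Fixpoint decide_sizes (q : nat) (v : option nat) (w : seq symbol) (n M r : nat) :
    bool :=
  match w, v with
  | [::], None => [&& n == 0, M == 0 & r == 0]
  | Bit b :: w', None => (b <= M) && decide_sizes q (Some (b : nat)) w' n (M - b) r
  | Bit b :: w', Some v =>
      [&& v != 0, v + b <= M
        & decide_sizes q (Some (v.*2 + b)) w' n (M - (v + b)) r]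
  | Comma :: w', Some v =>
      [&& q <= v, n != 0 & decide_sizes q None w' n.-1 M (r - (q < v))]
  | _, _ => false
  end.

(* [fresh] says that the head is at the start of a row, where the first size may
   come instead; only the symbol after the next bit tells which. *)
Fixpoint decide_rows (row : seq bool) (n : nat) (fresh : bool) (rest : seq bool)
    (w : seq symbol) : bool :=
  match w with
  | Bit b :: Slash :: w' =>
      match rest, w' with
      | c :: rest', Bit true :: Comma :: w'' =>
          (c == b) && decide_rows row n false rest' w''
      | _, _ => false
      end
  | Bit b :: w' =>
      let k := count id row in
      [&& fresh, n != 0
        & decide_sizes (k %/ n.+1) (Some (b : nat)) w' n.+1 (size row - b)
            (k %% n.+1)]
  | Semicolon :: w' =>
      [&& ~~ fresh, nilp rest & decide_rows row n.+1 true row w']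
  | _ => false
  end.

(** [l] is the part of the first row read so far, reversed, just as it lies to the left of the head
    on the row tape. *)
Fixpoint decide (l : seq bool) (w : seq symbol) : bool :=
  match w with
  | Bit b :: Slash :: Bit true :: Comma :: w' => decide (b :: l) w'
  | Semicolon :: w' => ~~ nilp l && decide_rows (rev l) 0 true (rev l) w'
  | _ => false
  end.

Lemma haltsS t a b : halts t (cstep a) b -> halts t.+1 a b.
Proof. by rewrite /halts iterSr. Qed.

Lemma halts_leq t t' a b : t <= t' -> halts t a b -> halts t' a b.
Proof.
move=> /subnK <-; rewrite /halts iterD; move: (iter t _ _) => c cb.
suff -> : iter (t' - t) cstep c = c by [].
elim: (_ - _) => //= u ->.
by case: c cb => ? ? ? ? ? ? ? ? ? ? /= ->.
Qed.

Lemma halts_reject t w y k n s m q r v :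
  halts t (Conf (Halt false) w y k n s m q r v) false.
Proof. by apply: (@halts_leq 0). Qed.

Local Ltac step := apply: haltsS; rewrite /= /update /=.

(** * Running time on the size vector *)

Section Sizes.
Variables (y : tape cell).

(** Like the loops below, this is stated in continuation form: from the time and verdict of the
    remaining run it derives those of the run that starts with the loop. *)
Lemma halts_clear w k n s m q r v t b :
  halts t (Conf NextSize w y k n s m q r 0) b ->
  halts (t + v.+1) (Conf Clear w y k n s m q r v) b.
Proof. by move=> h; elim: v => [|v IH]; rewrite addnS; step; rewrite ?addn0. Qed.

Lemma halts_restore w k n s m q r v t b :
  halts t (Conf Clear w y 0 n s m (q + k) r v) b ->
  halts (t + k.+1) (Conf Restore w y k n s m q r v) b.
Proof.
elim: k q => [|k IH] q h; rewrite addnS; step; first by move: h; rewrite !addn0.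
by apply: IH; rewrite addSnnS.
Qed.

Lemma halts_compare w k n s m q r v t b :
  halts t (Conf Restore w y (k + q) n s m 0 (r - (q < v)) (v - q)) b ->
  halts (t + q.+1) (Conf Compare w y k n s m q r v) ((q <= v) && b).
Proof.
elim: q k v => [|q IH] k v h; rewrite addnS.
  step; move: h; rewrite !addn0 subn0.
  by case: v => [|v]; rewrite ?subn0 ?subn1.
case: v h => [|v] h; step; first exact: halts_reject.
by apply: IH; rewrite addSnnS.
Qed.

Lemma halts_next_size w n s m q r v t b :
  halts t (Conf Size w y 0 n.-1 s m q (r - (q < v)) 0) b ->
  halts (t + (q.*2 + v + 4)) (Conf Compare w y 0 n s m q r v)
    [&& q <= v, n != 0 & b].
Proof.
move=> h.
have h1 : halts t.+1 (Conf NextSize w y 0 n s m (0 + (0 + q)) (r - (q < v)) 0)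
    ((n != 0) && b).
  rewrite !add0n; case: n h => [|n] h; step; first exact: halts_reject.
  exact: h.
have h2 := halts_restore (halts_clear (v - q) h1).
by apply: (halts_leq _ (halts_compare h2)); lia.
Qed.

Lemma halts_undouble w k n s m q r v t b :
  halts t (Conf Undouble w y k n 0 m q r (v + s.*2)) b ->
  halts (t + s.*2) (Conf Undouble w y k n s m q r v) b.
Proof.
elim: s v => [|s IH] v h; first by move: h; rewrite !addn0.
rewrite doubleS !addnS; step; step; apply: IH.
by move: h; rewrite doubleS !addnS !addSn.
Qed.

Lemma halts_double w k n s m q r v t b :
  (v <= m -> halts t (Conf Undouble w y k n (s + v) (m - v) q r 0) b) ->
  halts (t + v.+1) (Conf Double w y k n s m q r v) ((v <= m) && b).
Proof.
elim: v s m => [|v IH] s m h; rewrite addnS; step.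
  by move: h; rewrite !addn0 subn0 => h; apply: h.
case: m h => [|m] h /=; first exact: halts_reject.
by apply: IH; rewrite addSnnS.
Qed.

(** The value v has already been charged to M, so passing to 2v + c costs only v + c more and leaves
    the sum of V and M unchanged. The test [v != 0] excludes leading zeros. *)
Lemma halts_digit w (c : bool) n m q r v t b :
  (v + c <= m -> halts t (Conf Digit w y 0 n 0 (m - (v + c)) q r (v.*2 + c)) b) ->
  halts (t + (v * 3 + 3))
    (Conf Digit (Bit c :: w) y 0 n 0 m q r v) [&& v != 0, v + c <= m & b].
Proof.
move=> h; rewrite addnC addnS addSn; step.
case: v h => [|v] h /=; first exact: halts_reject.
(* The machine makes the two tests separately: [Double] charges v, and [Undouble] then charges the
   new bit. *)
have E : (v.+1 + c <= m) = (v.+1 <= m) && (c <= m - v.+1) by lia.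
rewrite {}E -andbA.
have h' : v.+1 <= m ->
    halts t.+1 (Conf Undouble (Bit c :: w) y 0 n 0 (m - v.+1) q r (0 + v.+1.*2))
      ((c <= m - v.+1) && b).
  move=> vm; rewrite add0n; step.
  case: c h => h; last by move: h; rewrite /= !addn0 => h; apply: h.
  case E: (m - v.+1) => [|m'] /=; first exact: halts_reject.
  have -> : m' = m - v.+2 by lia.
  by move: h; rewrite /= !addn1; apply; lia.
have /halts_double : v.+1 <= m ->
  halts (t.+1 + v.+1.*2)
    (Conf Undouble (Bit c :: w) y 0 n (0 + v.+1) (m - v.+1) q r 0)
   ((c <= m - v.+1) && b) by move=> vm; apply/halts_undouble/h'.
by apply: halts_leq; lia.
Qed.

(** The sum of V and M never grows: digits preserve it and a comma drops V. So L bounds V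
    throughout; a digit costs at most 3V + 3 steps and a comma at most 2q + V + 5. *)
Lemma halts_sizes L q v w n m r :
  q <= L -> odflt 0 v + m <= L ->
  halts ((L * 3 + 5) * (size w).+1)
    (if v is Some v then Conf Digit w y 0 n 0 m q r v
     else Conf Size w y 0 n 0 m q r 0)
    (decide_sizes q v w n m r).
Proof.
move=> qL; elim: w v n m r => [|x w IH] v n m r vmL.
  apply: (@halts_leq 2); first by lia.
  case: v vmL => [v|] vmL; step; first exact: halts_reject.
  by case: n m r vmL => [|n] [|m] [|r] vmL; try exact: halts_reject.
rewrite mulnS addnC [size _]/=; set t := _ * (size w).+1 in IH *.
have -> : t + (L * 3 + 5) = (t + (L * 3 + 4)).+1 by lia.
have tS k n' m' q' r' v' b' : halts t (Conf k w y 0 n' 0 m' q' r' v') b' ->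
    halts (t + (L * 3 + 4)) (Conf k w y 0 n' 0 m' q' r' v') b'.
  by apply: halts_leq; lia.
case: v vmL => [v|] /= vmL.
  case: x => [c|||] /=; try by step; exact: halts_reject.
    have vt : t + (v * 3 + 3) <= (t + (L * 3 + 4)).+1 by lia.
    apply: (halts_leq vt); apply: halts_digit => vcm.
    by apply: (IH (Some _)) => /=; lia.
  step.
  have vt : t + (q.*2 + v + 4) <= t + (L * 3 + 4) by lia.
  by apply: (halts_leq vt); apply: halts_next_size; apply: (IH None) => /=; lia.
case: x => [[]|||] /=; step; try exact: halts_reject;
  last by rewrite subn0; apply/tS/(IH (Some 0)).
case: m vmL => [|m] vmL; first exact: halts_reject.
by rewrite subn1; apply/tS/(IH (Some 1)) => /=; lia.
Qed.
End Sizes.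

(** * Division by repeated subtraction *)

Lemma halts_div_next w y k n s m q r v t b :
  halts t (Conf Div w y k (n + s) 0 m q r v) b ->
  halts (t + s.+1) (Conf DivNext w y k n s m q r v) b.
Proof.
elim: s n => [|s IH] n h; rewrite addnS; step; first by move: h; rewrite !addn0.
by apply: IH; rewrite addSnnS.
Qed.

Lemma halts_div_last w y n s m q r v t b :
  halts t (Conf Digit w y 0 (n + s) 0 m q (r + s) v) b ->
  halts (t + s.+1) (Conf DivLast w y 0 n s m q r v) b.
Proof.
elim: s n r => [|s IH] n r h; rewrite addnS; step.
  by move: h; rewrite !addn0.
by apply: IH; rewrite !addSnnS.
Qed.

Lemma halts_div_round d w y k n s m q r v t b :
  halts t (Conf Div w y k n (s + d) m q r v) b ->
  halts (t + d) (Conf Div w y (k + d) (n + d) s m q r v) b.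
Proof.
elim: d s => [|d IH] s h; first by move: h; rewrite !addn0.
by rewrite !addnS; step; apply: IH; rewrite addSnnS.
Qed.

(** A full round subtracts n from k in 2n + 2 steps, which is at most 4n as n is positive; the final
    partial round takes 2k + 2 steps. This gives the bound 4k + 2. *)
Lemma halts_div w y k n m q v t b : 0 < n ->
  halts t (Conf Digit w y 0 n 0 m (q + k %/ n) (k %% n) v) b ->
  halts (t + (k * 4 + 2)) (Conf Div w y k n 0 m q 0 v) b.
Proof.
move=> n0; have [j] := ubnP k; elim: j => // j IH in k q *; rewrite ltnS => kj h.
case: (ltnP k n) => kn.
  rewrite divn_small // modn_small // addn0 in h.
  have nE : n - k + k = n by lia.
  have : halts (t + k.+2) (Conf Div w y 0 (n - k) (0 + k) m q 0 v) b.
    (* [Div] tests N before K. As k < n, N is still positive when K runs out, so the next state is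
       [DivLast]. *)
    case E : (n - k) => [|n']; first by lia.
    rewrite addnS; step; apply: halts_div_last.
    by rewrite -E nE.
  move=> /halts_div_round; rewrite nE add0n.
  by apply: halts_leq; lia.
have kE : (k - n) + n = k by lia.
rewrite -kE divnDr // divnn n0 modnDr addnA addnAC in h.
have /IH : k - n < j by lia.
move/(_ (q + 1) h) => {}h.
have : halts (t + ((k - n) * 4 + 2) + n.+2)
    (Conf Div w y (k - n) 0 (0 + n) m q 0 v) b.
  rewrite addnS; step; apply: halts_div_next; rewrite add0n.
  by rewrite addn1 in h.
move=> /halts_div_round; rewrite kE add0n.
by apply: halts_leq; lia.
Qed.

(* The trailing blank is stored once the head has reached the end of the row. *)
Definition row_tape (l rest : seq bool) : tape cell :=
  Tape (rcons [seq bit_cell b | b <- l] mark)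
    (if rest is b :: _ then bit_cell b else None)
    (if rest is _ :: rest' then rcons [seq bit_cell b | b <- rest'] None
     else [::]).

(** * Running time on the rows and on the whole input *)

Lemma halts_rewind l rest w k n s m q r v t b :
  halts t (Conf (Entry true) w (row_tape [::] (catrev l rest)) k n s m q r v) b ->
  halts (t + (size l).+2) (Conf Rewind w (row_tape l rest) k n s m q r v) b.
Proof.
elim: l rest => [|c l IH] rest h.
  rewrite !addnS addn0; case: rest h => [|c rest] h; do 2!step; first exact: h.
  by case: rest h.
rewrite [size _]/= addnS; case: rest h => [|d rest] h; step.
  exact: (IH [:: c]).
exact: (IH (c :: d :: rest)).
Qed.

Lemma halts_rows_end L w y k n m (b : bool) : 0 < L -> k <= L -> m <= L ->
  halts ((L * 7 + 10) * (size w).+1)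
    (Conf Div w y k n.+1 0 (m - b) 0 0 b)
    (decide_sizes (k %/ n.+1) (Some (nat_of_bool b)) w n.+1 (m - b) (k %% n.+1)).
Proof.
move=> L0 kL mL.
have qL : k %/ n.+1 <= L by apply: leq_trans (leq_div _ _) kL.
have vmL : odflt 0 (Some (nat_of_bool b)) + (m - b) <= L by case: b => /=; lia.
have := @halts_sizes y L _ _ w n.+1 _ (k %% n.+1) qL vmL.
rewrite -[k %/ _]add0n => /halts_div -/(_ isT).
by apply: halts_leq; nia.
Qed.

(** The row is split at the head into [l], reversed, and [rest]. The induction is on the length of
    the input because an entry consumes four symbols at once. The constant per symbol covers the
    rewinding after a semicolon and, through [halts_rows_end], the division and the sizes. *)
Lemma halts_rows L row l rest w n fresh :
  0 < L -> size row <= L -> catrev l rest = row ->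
  halts ((L * 7 + 20) * (size w).+1)
    (Conf (Entry fresh) w (row_tape l rest) (count id row) n 0 (size row) 0 0 0)
    (decide_rows row n fresh rest w).
Proof.
move=> L0 rowL.
have [j] := ubnP (size w); elim: j => // j IH in w n fresh l rest *.
rewrite ltnS => wj rowE.
rewrite mulnS addnC; move tE: (_ * size w) => t.
have -> : t + (L * 7 + 20) = (t + (L * 7 + 18)).+2 by lia.
have kL : count id row <= L by apply: leq_trans (count_size _ _) rowL.
case: w wj tE => [|x w] /= wj tE; first by (step; exact: halts_reject).
case: x => [b|||]; try by (step; exact: halts_reject).
2: {
  case: fresh; first by (step; exact: halts_reject).
  case: rest rowE => [|c rest] rowE; step; last exact: halts_reject.
  have : halts t (Conf (Entry true) w (row_tape [::] (catrev l [::])) (count id row)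
            n.+1 0 (size row) 0 0 0) (decide_rows row n.+1 true row w).
    by rewrite rowE -tE; apply: IH.
  have lL : size l <= L by move: rowL; rewrite -rowE catrevE size_cat size_rev addn0.
  by move=> /halts_rewind; apply: halts_leq; lia. }
(* No slash follows the bit, so it is the first digit of the first size. *)
have rowsE w' : (if w' is Slash :: _ then false else true) ->
  halts ((L * 7 + 10) * (size w').+1 + 2)
    (Conf (Entry fresh) (Bit b :: w') (row_tape l rest) (count id row) n 0
       (size row) 0 0 0)
    [&& fresh, n != 0
        & decide_sizes (count id row %/ n.+1) (Some (b : nat)) w' n.+1 (size row - b)
            (count id row %% n.+1)].
  move=> w'S; have : 0 < n -> halts ((L * 7 + 10) * (size w').+1)
      (Conf Div w' (row_tape l rest) (count id row) n.+1 0 (size row - b) 0 0 b)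
      (decide_sizes (count id row %/ n.+1) (Some (nat_of_bool b)) w' n.+1
        (size row - b) (count id row %% n.+1)).
    by move=> _; apply: halts_rows_end.
  rewrite addn2; case: w' w'S => [|[c|||] w'] // _ h;
    case: fresh; case: n h => [|n] h; case: b h => /= h;
    do 2!step; try exact: halts_reject;
    by have := h isT; rewrite ?subn1 ?subn0.
case: w wj tE => [|x w] /= wj tE.
  by apply: (halts_leq _ (rowsE [::] isT)) => /=; lia.
have rowsE' x' : x' <> Slash ->
    halts (t + (L * 7 + 18)).+2 (Conf (Entry fresh) (Bit b :: x' :: w)
      (row_tape l rest) (count id row) n 0 (size row) 0 0 0)
    [&& fresh, n != 0
        & decide_sizes (count id row %/ n.+1) (Some (b : nat)) (x' :: w) n.+1
            (size row - b) (count id row %% n.+1)].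
  move=> xS; apply: (halts_leq _ (rowsE (x' :: w) _)) => /=; first lia.
  by case: x' xS.
case: x wj => [c|||] wj; try exact: rowsE'.
rewrite {rowsE rowsE'}/row_tape.
case: rest rowE => [|d rest] rowE; first by case: b; do 2!step; exact: halts_reject.
case: eqP => [db|/eqP/negPf db] /=; last first.
  suff -> : match w with Bit true :: Comma :: w'' => false | _ => false end = false.
    by case: b d db {rowE} => -[] // _; do 2!step; exact: halts_reject.
  by case: (w) => [|[[]|||] [|[]]].
have : halts (t + (L * 7 + 18)) (Conf (One false) w (row_tape (d :: l) rest)
     (count id row) n 0 (size row) 0 0 0)
   match w with
   | Bit true :: Comma :: w'' => decide_rows row n false rest w''
   | _ => false
   end.
  have -> : t + (L * 7 + 18) = (t + (L * 7 + 16)).+2 by lia.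
  case: w tE wj => [|[[]|||] w] /= tE wj; step; try exact: halts_reject.
  case: w tE wj => [|[c|||] w] /= tE wj; step; try exact: halts_reject.
  have /halts_leq : (L * 7 + 20) * (size w).+1 <= t + (L * 7 + 16) by lia.
  apply; apply: IH; last exact: rowE.
  by lia.
rewrite /row_tape -db; case: d {db rowE} => h; do 2!step.
all: by case: rest h => [|[] rest] h; exact: h.
Qed.

Lemma halts_first_row L l w :
  0 < L -> size l + size w <= L ->
  halts ((L * 7 + 20) * (size w).+1)
    (Conf FirstEntry w (row_tape l [::]) (count id l) 0 0 (size l) 0 0 0)
    (decide l w).
Proof.
move=> L0.
have [j] := ubnP (size w); elim: j => // j IH in w l *; rewrite ltnS => wj lwL.
rewrite mulnS addnC; move tE: (_ * size w) => t.
have -> : t + (L * 7 + 20) = (t + (L * 7 + 16)).+4 by lia.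
case: w wj lwL tE => [|x w] /= wj lwL tE; first by (step; exact: halts_reject).
case: x => [b|||]; try by (step; exact: halts_reject).
2: {
  case: l lwL => [|c l] /= lwL; step; first exact: halts_reject.
  set row := rev (c :: l).
  have kE : nat_of_bool c + count id l = count id row by rewrite count_rev.
  have sE : (size l).+1 = size row by rewrite size_rev.
  have : halts t (Conf (Entry true) w (row_tape [::] (catrev (c :: l) [::]))
     (c + count id l) 0 0 (size l).+1 0 0 0) (decide_rows row 0 true row w).
    by rewrite kE sE -tE; apply: halts_rows => //; rewrite -sE /=; lia.
  move=> /halts_rewind; apply: halts_leq; rewrite /=; lia. }
have E : (size l).+1 + size w <= L by lia.
case: b; rewrite /row_tape; step.
all: case: w wj tE lwL E => [|[[]|||] w] /= wj tE lwL E; step;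
  try exact: halts_reject.
all: case: w wj tE lwL E => [|[[]|||] w] /= wj tE lwL E; step;
  try exact: halts_reject.
all: case: w wj tE lwL E => [|[[]|||] w] /= wj tE lwL E; step;
  try exact: halts_reject.
all: have /halts_leq : (L * 7 + 20) * (size w).+1 <= t + (L * 7 + 16) by lia.
all: apply; apply: (IH w (_ :: l)) => /=; lia.
Qed.

Lemma halts_decide w :
  verdict_after reform_tm (100 * size w ^ 2 + 100) w = Some (decide [::] w).
Proof.
(* The split-off step is the initial one, which leaves [Start]. *)
have -> : 100 * size w ^ 2 + 100 = (100 * size w ^ 2 + 99).+1 by lia.
apply: halts_verdict_after.
(* L is taken as s + 1 to be positive, where s is the input length. Then (7L + 20)(s + 1) = 7s^2 +
   34s + 27, at most 41s^2 + 27. *)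
have := @halts_first_row (size w).+1 [::] w isT (leqnSn _).
apply: halts_leq; rewrite -mulnn; move: (size w) => s.
have : s <= s * s by case: s => // s; rewrite leq_pmull.
by lia.
Qed.

(** * Encodings *)

Definition balanced (k : nat) (s : seq nat) : bool :=
  all (leq (k %/ size s)) s &&
  (k %% size s <= count (fun x => k %/ size s < x) s).

Definition encode_sizes (s : seq nat) : seq symbol :=
  flatten [seq rcons (encode_nat x) Comma | x <- s].

(** The utilities 0 and 1 are written as the fractions 0/1 and 1/1, hence the constant
    denominator. *)
Definition encode_row (row : seq bool) : seq symbol :=
  rcons (flatten [seq [:: Bit b; Slash; Bit true; Comma] | b <- row]) Semicolon.

Lemma encode_nat_pos (p : BinNums.positive) : encode_nat (nat_of_pos p) = encode_pos p.
Proof. by rewrite /encode_nat (nat_of_binK (BinNums.Npos p)). Qed.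

Lemma nat_of_pos_ex v : 0 < v -> exists p : BinNums.positive, v = nat_of_pos p.
Proof.
rewrite -{2}(bin_of_natK v) -{1}(bin_of_natK v).
by case: (bin_of_nat v) => // p; exists p.
Qed.

Lemma nat_of_posD (p : BinNums.positive) (b : bool) :
  (nat_of_pos p).*2 + b = nat_of_pos (if b then BinNums.xI p else BinNums.xO p).
Proof. by case: b => /=; rewrite NatTrec.doubleE ?addn1 ?addn0. Qed.

(** Positivity matters: the numeral of 0 is a bit itself, so appending to it would create a leading
    zero. *)
Lemma encode_nat_double v (b : bool) : 0 < v ->
  encode_nat (v.*2 + b) = rcons (encode_nat v) (Bit b).
Proof.
by move=> /nat_of_pos_ex[p ->]; rewrite nat_of_posD !encode_nat_pos; case: b.
Qed.

Lemma encode_nat_bits x : exists b u, encode_nat x = Bit b :: [seq Bit c | c <- u].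
Proof.
rewrite /encode_nat; case: bin_of_nat => [|p]; first by exists false, [::].
elim: p => [p [b [u /= ->]]|p [b [u /= ->]]|]; last by exists true, [::].
  by exists b, (rcons u true); rewrite map_rcons.
by exists b, (rcons u false); rewrite map_rcons.
Qed.

(** For the induction on [w], a pending value [v] contributes its numeral in front of [w] and its
    amount to the total. Truncation in [r - (q < v)] is what turns the final test [r == 0] into a
    lower bound on the count. *)
Lemma decide_sizes_sound q v w n M r : decide_sizes q v w n M r ->
  exists s, [/\ oapp encode_nat [::] v ++ w = encode_sizes s, size s = n,
    sumn s = odflt 0 v + M, all (leq q) s & r <= count (fun x => q < x) s].
Proof.
elim: w v n M r => [|x w IH] v n M r.
  by case: v => //= /and3P[/eqP-> /eqP-> /eqP->]; exists [::].
case: x v => [b|||] [v|] //=.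
- case/and3P=> v0 vM /IH[s /= [sE szs sums sq sr]].
  exists s; split=> //; last by lia.
  by rewrite -sE encode_nat_double ?lt0n // cat_rcons.
- case/andP=> bM /IH[s /= [sE szs sums sq sr]].
  exists s; split=> //; last by lia.
  by rewrite -sE; case: (b).
- case/and3P=> qv n0 /IH[s /= [-> szs sums sq sr]].
  exists (v :: s); split=> /=; first by rewrite /encode_sizes /= cat_rcons.
  + by rewrite szs prednK // lt0n.
  + by rewrite sums.
  + by rewrite qv.
  by lia.
Qed.

Lemma nat_of_pos_gt0 (p : BinNums.positive) : 0 < nat_of_pos p.
Proof. by elim: p => //= p; rewrite NatTrec.doubleE; lia. Qed.

(** If x is positive, every nonempty prefix of its numeral has a positive value at most x, so
    neither the test for leading zeros nor the one against M fails on the way. *)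
Lemma decide_sizes_nat q x w n M r : x <= M ->
  decide_sizes q None (encode_nat x ++ w) n M r =
  decide_sizes q (Some x) w n (M - x) r.
Proof.
case: x => [|x] //.
have [p ->] := @nat_of_pos_ex x.+1 isT; rewrite encode_nat_pos.
have bit (p' : BinNums.positive) (b : bool) u :
  nat_of_pos p' <= M -> (nat_of_pos p').*2 + b <= M ->
  decide_sizes q (Some (nat_of_pos p')) (Bit b :: u) n (M - nat_of_pos p') r =
  decide_sizes q (Some ((nat_of_pos p').*2 + b)) u n
    (M - ((nat_of_pos p').*2 + b)) r.
  move=> pM pM2; have p0 := nat_of_pos_gt0 p'.
  rewrite /= -lt0n p0 (_ : _ + b <= _) /=; last by lia.
  by congr decide_sizes; lia.
elim: p w => [p IH|p IH|] w pM; last by rewrite /= pM.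
  rewrite -(nat_of_posD p true) in pM *.
  by rewrite [encode_pos _]/= cat_rcons IH ?bit //; lia.
rewrite -(nat_of_posD p false) in pM *.
by rewrite [encode_pos _]/= cat_rcons IH ?bit //; lia.
Qed.

Lemma decide_sizes_complete q s r :
  all (leq q) s -> r <= count (fun x => q < x) s ->
  decide_sizes q None (encode_sizes s) (size s) (sumn s) r.
Proof.
elim: s r => [|x s IH] r /=; first by rewrite leqn0 => _ ->.
case/andP=> qx qs rs; rewrite /encode_sizes /= cat_rcons decide_sizes_nat ?leq_addr //=.
by rewrite qx addKn; apply: IH => //; lia.
Qed.

Definition encoding (n : nat) (row : seq bool) (s : seq nat) : seq symbol :=
  flatten (nseq n (encode_row row)) ++ encode_sizes s.

(** The agents are the first row, the n rows completed after it, the row in progress if [fresh] is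
    false, and the j rows still to come. *)
Lemma decide_rows_sound (row : seq bool) n (fresh : bool) (rest : seq bool) w :
  row != [::] -> (fresh -> rest = row) ->
  decide_rows row n fresh rest w -> exists j s,
  [/\ w = (if fresh then [::] else encode_row rest) ++ encoding j row s,
      size s = (n + ~~ fresh + j).+1, 1 < size s, sumn s = size row
    & balanced (count id row) s].
Proof.
move=> row0; have [m] := ubnP (size w).
elim: m => // m IH in n fresh rest w *; rewrite ltnS => wm restE.
have row_gt0 : 0 < size row by case: (row) row0.
have last_row (b : bool) w' :
    [&& fresh, n != 0
    & decide_sizes (count id row %/ n.+1) (Some (b : nat)) w' n.+1 (size row - b)
            (count id row %% n.+1)] ->
    exists j s,
  [/\ Bit b :: w' = (if fresh then [::] else encode_row rest) ++ encoding j row s,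
      size s = (n + ~~ fresh + j).+1, 1 < size s, sumn s = size row
    & balanced (count id row) s].
  case/and3P=> -> n0 /decide_sizes_sound[s [/= sE szs sums sq sr]].
  exists 0, s; rewrite szs addn0 addn0; split=> //.
  - by rewrite /encoding /= -sE; case: (b).
  - by lia.
  - by lia.
  by rewrite /balanced szs sq.
case: w wm => [|[b|||] w] // wm; last first.
  rewrite /= => /and3P[fr /nilP-> dec].
  have [j [s [-> szs s1 sums bal]]] := IH n.+1 true row w wm (fun=> erefl) dec.
  by exists j, s; rewrite (negPf fr); split=> //; rewrite szs /=; lia.
case: w wm => [|[c|||] w] wm; try exact: last_row.
case: rest restE {last_row} => [|d rest] restE //=.
case: w wm => [|[[]|||] w] //= wm; case: w wm => [|[|||] w] //= wm.
case/andP=> /eqP cb dec; have wm' : size w < m by lia.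
have [//|j [s [-> szs s1 sums bal]]] := IH n false rest w wm' _ dec; subst d.
(* If the entry just read opened a row, that row belongs to those still to come, which raises j by
   one. *)
have [fr|] := boolP fresh.
  exists j.+1, s; split=> //; last by rewrite szs; lia.
  by rewrite /encoding /= -catA -(restE fr).
by exists j, s; split.
Qed.

Lemma decide_rows_encode_row row n (fresh : bool) (rest : seq bool) w :
  (fresh -> rest != [::]) ->
  decide_rows row n fresh rest (encode_row rest ++ w) =
  decide_rows row n.+1 true row w.
Proof.
elim: rest fresh => [|b rest IH] fresh fr /=.
  by case: fresh fr => // /(_ isT).
by rewrite eqxx IH.
Qed.

Lemma decide_rows_complete (row : seq bool) n j s :
  row != [::] -> size s = (n + j).+1 -> 1 < size s -> sumn s = size row ->
  balanced (count id row) s -> decide_rows row n true row (encoding j row s).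
Proof.
move=> row0; elim: j n => [|j IH] n szs s1 sums bal; last first.
  by rewrite /encoding /= -catA decide_rows_encode_row //; apply: IH => //; lia.
case/andP: bal => sq sr; have := decide_sizes_complete sq sr.
rewrite addn0 in szs; rewrite szs sums /encoding cat0s.
case: s szs {sums sq sr} s1 => [//|x s] szs s1.
(* The first bit of a size is followed by a bit or a comma, never by a slash; this separates it from
   an entry. *)
have [b [u xE]] := encode_nat_bits x.
have -> : encode_sizes (x :: s) =
    Bit b :: ([seq Bit c | c <- u] ++ Comma :: encode_sizes s).
  by rewrite /encode_sizes /= cat_rcons xE.
have rowsE u' : (if u' is Slash :: _ then false else true) ->
  decide_rows row n true row (Bit b :: u') =
  (n != 0) && decide_sizes (count id row %/ n.+1) (Some (b : nat)) u' n.+1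
     (size row - b) (count id row %% n.+1) by case: u' => [|[]].
rewrite rowsE; last by case: (u).
by case/andP=> _ dec; apply/andP; split; last exact: dec; rewrite -lt0n -ltnS -szs.
Qed.

Lemma decide_encode_row l rest w :
  decide l (encode_row rest ++ w) =
  ~~ nilp (catrev l rest) && decide_rows (catrev l rest) 0 true (catrev l rest) w.
Proof.
elim: rest l => [|b rest IH] l /=; last by rewrite IH.
by rewrite -[catrev l [::]]/(rev l) /nilp size_rev.
Qed.

Lemma decide_first_row l w : decide l w -> exists rest w', w = encode_row rest ++ w'.
Proof.
have [m] := ubnP (size w); elim: m => // m IH in l w *; rewrite ltnS.
case: w => [|[b|||] w] //= wm; last by exists [::], w.
case: w wm => [|[|||] w] //= wm; case: w wm => [|[[]|||] w] //= wm.
case: w wm => [|[|||] w] //= wm dec.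
have [|rest [w' ->]] := IH (b :: l) w _ dec; first by lia.
by exists (b :: rest), w'.
Qed.

Theorem decideP w : reflect (exists row s,
  [/\ row != [::], 1 < size s, w = encoding (size s) row s, sumn s = size row
    & balanced (count id row) s]) (decide [::] w).
Proof.
apply: (iffP idP) => [dec|[row [s [row0 s1 -> sums bal]]]].
  have [row [w' wE]] := decide_first_row dec; move: dec.
  rewrite wE decide_encode_row /nilp size_eq0 => /andP[row0].
  move/(decide_rows_sound row0 (fun=> erefl)) => [j [s [-> szs s1 sums bal]]].
  by exists row, s; split=> //; rewrite szs /encoding /= catA.
case: s s1 sums bal => [//|x s] s1 sums bal.
rewrite /encoding /= -catA decide_encode_row /nilp size_eq0 row0.
exact: decide_rows_complete.
Qed.

(** * EF1 allocations *)

Import Order.TTheory GRing.Theory Num.Theory.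

Lemma exists_subset (T : finType) (S : {set T}) k : k <= #|S| ->
  exists2 B : {set T}, B \subset S & #|B| = k.
Proof.
move=> kS; exists [set x in take k (enum S)].
  by apply/subsetP=> x; rewrite inE => /mem_take; rewrite mem_enum.
rewrite cardsE; have /card_uniqP-> := take_uniq k (enum_uniq S).
by rewrite size_takel // -cardE.
Qed.

(** List [c i] copies of each i; the list has length [#|S|], and f sends the p-th element of S to
    its p-th entry. Outside S, f takes the default [i0]. *)
Lemma exists_fibers (T : finType) n (i0 : 'I_n) (c : 'I_n -> nat) (S : {set T}) :
  #|S| = \sum_i c i ->
  exists f : T -> 'I_n, forall i, #|[set x in S | f x == i]| = c i.
Proof.
move=> Sc; pose L := flatten [seq nseq (c i) i | i <- enum 'I_n].
have sL : size L = #|S|.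
  rewrite size_flatten /shape -map_comp Sc sumnE big_map big_enum /=.
  by apply: eq_bigr => i _; rewrite size_nseq.
have cL i : count_mem i L = c i.
  rewrite count_flatten -map_comp sumnE big_map big_enum /= (bigD1 i) //=.
  rewrite count_nseq /= eqxx mul1n big1 ?addn0 // => j /negPf ji.
  by rewrite count_nseq /= ji.
exists (fun x => nth i0 L (index x (enum S))) => i.
rewrite -(cL i).
have {2}-> : L = [seq nth i0 L (index x (enum S)) | x <- enum S].
  apply: (@eq_from_nth _ i0); first by rewrite size_map -cardE.
  move=> p; rewrite sL cardE => pS; case: (pickP (mem S)) => [x0 _|S0]; last first.
    by rewrite -cardE (eq_card0 S0) in pS.
  by rewrite (nth_map x0) // index_uniq // enum_uniq.
rewrite count_map -size_filter cardE; congr size.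
rewrite {1}/enum_mem -filter_predI; apply: eq_filter => x /=.
by rewrite !inE andbC.
Qed.

Lemma balancedP n (k : nat) (s : 'I_n -> nat) : 0 < n ->
  reflect (exists a : 'I_n -> nat, [/\ \sum_i a i = k, forall i, a i <= s i
                                    & forall i j, a i <= (a j).+1])
    (balanced k [seq s i | i <- enum 'I_n]).
Proof.
move=> n0; rewrite /balanced size_map size_enum_ord all_map count_map.
set q := k %/ n; set r := k %% n.
have kE : k = n * q + r by rewrite mulnC; apply: divn_eq.
have rn : r < n by apply: ltn_pmod.
have -> : count (preim s (fun x => q < x)) (enum 'I_n) = #|[set i | q < s i]|.
  by rewrite -sum1_card -sum1_count big_enum_cond; apply: eq_bigl => i; rewrite inE.
apply: (iffP andP) => [[/allP qs rs]|[a [ak as_ aa]]].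
  (* J consists of r indices with size above q; these receive q + 1 and the others q. *)
  have [J Js Jr] := exists_subset rs.
  exists (fun i => q + (i \in J)); split.
  - rewrite big_split /= sum_nat_const card_ord -sum1_card big_mkcond /= in Jr *.
    by rewrite kE -Jr; congr addn; apply: eq_bigr => i _; case: (i \in J).
  - move=> i; have := qs i; rewrite mem_enum => /(_ isT) /= qi.
    case: (boolP (i \in J)) => [/(subsetP Js)|_]; rewrite ?inE; lia.
  by move=> i j; case: (i \in J); case: (j \in J); lia.
(* If a_i < q, then all a_j are at most q and one is smaller, so the total is below nq. *)
have aq i : q <= a i.
  rewrite leqNgt; apply/negP => ai.
  have : \sum_j a j < \sum_(j < n) q.
    rewrite (bigD1 i) //= [X in _ < X](bigD1 i) //= -addSn leq_add //.
    by apply: leq_sum => j _; apply: leq_trans (aa j i) ai.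
  by rewrite ak sum_nat_const card_ord kE; lia.
split; first by apply/allP => i _; apply: leq_trans (aq i) (as_ i).
rewrite leqNgt; apply/negP => rs.
(* If some a_i exceeds q + 1, then all a_j are at least q + 1, so the total is at least nq + n >
   k. *)
have a1 i : a i <= q.+1.
  rewrite leqNgt; apply/negP => ai.
  have : \sum_(j < n) q.+1 <= \sum_j a j.
    by apply: leq_sum => j _; have := aa i j; lia.
  by rewrite ak sum_nat_const card_ord kE; lia.
(* Now a_j = q + 1 requires s_j > q, so summing gives at least r indices with size above q. *)
have : \sum_j a j <= \sum_(j < n) (q + (q < s j)).
  by apply: leq_sum => j _; have := a1 j; have := aq j; have := as_ j; lia.
rewrite ak big_split /= sum_nat_const card_ord kE leq_add2l leqNgt => /negP; apply.
apply: leq_trans rs; rewrite ltnS -sum1_card [X in _ <= X]big_mkcond /=.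
by apply: leq_sum => j _; rewrite inE; case: ifP.
Qed.

Section IdenticalBinary.
Variables (I : instance rat) (i0 : 'I_(agents I)).
Hypothesis IB : identical_binary I.

Definition valuable : {set 'I_(goods I)} := [set g | utility i0 [set g] == 1%R].

Lemma utilityE i B : utility i B = (#|B :&: valuable|%:R)%R.
Proof.
case: IB => same bin; rewrite (same i i0) utility_additive -sum1_card natr_sum.
rewrite (eq_bigl (fun g => (g \in B) && (g \in valuable))) => [|g]; last by rewrite inE.
rewrite big_mkcondr /=; apply: eq_bigr => g _; rewrite inE.
by case: (bin i0 g) => ->; rewrite ?eqxx // eq_sym oner_eq0.
Qed.

Lemma card_valuable_allocation A : is_allocation A ->
  (\sum_i #|A i :&: valuable| = #|valuable|)%N.
Proof.
case=> disj cover; rewrite -sum1_card.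
under eq_bigr => i _ do rewrite -sum1_card big_mkcond /=.
rewrite exchange_big [RHS]big_mkcond /=; apply: eq_bigr => g _.
have: g \in \bigcup_i A i by rewrite cover inE.
case/bigcupP=> i _ gi; rewrite (bigD1 i) //= inE gi /=.
rewrite big1 ?addn0 // => j ji; rewrite inE.
have := disj j i ji; rewrite disjoint_sym => /disjointFr-> //.
Qed.

(** Removing a valuable good lowers the value of the bundle by 1, the most possible; if a nonempty
    bundle has none, its value is 0 and any good serves. *)
Lemma EF1_towardsE A i j :
  EF1_towards A i j <-> (#|A j :&: valuable| <= (#|A i :&: valuable|).+1)%N.
Proof.
rewrite /EF1_towards; split=> [[->|[g gA]]|le_ji].
- by rewrite set0I cards0.
- rewrite !utilityE ler_nat setIDAC (cardsD1 g (A j :&: _)) => le_ji.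
  by apply: leq_trans (leq_add (leq_b1 _) le_ji) _.
have [->|[g gA]] := set_0Vmem (A j); [by left | right].
have [V0|[h]] := set_0Vmem (A j :&: valuable).
  by exists g => //; rewrite !utilityE ler_nat setIDAC V0 set0D cards0.
move=> hA; exists h; first by case/setIP: hA.
by rewrite !utilityE ler_nat setIDAC; move: le_ji; rewrite (cardsD1 h) hA.
Qed.

Lemma reformable_balanced (s : 'I_(agents I) -> nat) : is_size_vector s ->
  reformable s <-> balanced #|valuable| [seq s i | i <- enum 'I_(agents I)].
Proof.
move=> ss; have n0 : (0 < agents I)%N by apply: leq_trans (agents_ge2 I).
split=> [[A [alloc sizes ef1]]|/balancedP-/(_ n0) [a [ak as_ aa]]].
  apply/balancedP => //; exists (fun i => #|A i :&: valuable|); split.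
  - exact: card_valuable_allocation.
  - by move=> i; rewrite -sizes subset_leq_card // subsetIl.
  move=> i j; have [->|ij] := eqVneq i j; first exact: leqnSn.
  by apply/EF1_towardsE/ef1; rewrite eq_sym.
(* The valuable goods are distributed by f with fibres of size a_i, the worthless ones by h with
   fibres of size s_i - a_i. *)
have [f fE] := exists_fibers i0 (esym ak).
have [|h hE] := @exists_fibers _ _ i0 (fun i => s i - a i)%N (~: valuable).
  by rewrite sumnB // ak ss -[X in _ = X - _]card_ord -(cardsC valuable) addKn.
pose A i := [set g | (if g \in valuable then f g else h g) == i].
have AV i : A i :&: valuable = [set g in valuable | f g == i].
  by apply/setP => g; rewrite !inE; case: ifP; rewrite ?andbT ?andbF.
have AC i : A i :\: valuable = [set g in ~: valuable | h g == i].
  by apply/setP => g; rewrite !inE; case: ifP.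
exists A; split.
- split=> [i j ij|].
    rewrite -setI_eq0; apply/eqP/setP=> g; rewrite !inE.
    by apply/negP => /andP[/eqP-> /eqP ji]; rewrite ji eqxx in ij.
  apply/setP=> g; rewrite inE; apply/bigcupP.
  by exists (if g \in valuable then f g else h g); rewrite ?inE.
- by move=> i; rewrite -(cardsID valuable) AV AC fE hE subnKC.
by move=> i j _; apply/EF1_towardsE; rewrite !AV !fE.
Qed.

Definition value_row : seq bool :=
  [seq utility i0 [set g] == 1%R | g <- enum 'I_(goods I)].

Lemma count_value_row : count id value_row = #|valuable|.
Proof.
rewrite count_map -sum1_card -sum1_count big_enum_cond.
by apply: eq_bigl => g; rewrite [in RHS]inE.
Qed.

Lemma encode_rat_bin (b : bool) : encode_rat (b%:R)%R = [:: Bit b; Slash; Bit true].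
Proof. by case: b. Qed.

Lemma encodeE (s : 'I_(agents I) -> nat) :
  encode s = encoding (agents I) value_row [seq s i | i <- enum 'I_(agents I)].
Proof.
rewrite /encode /encoding /encode_sizes -map_comp; congr (flatten _ ++ _).
rewrite (@eq_map _ _ _ (fun=> encode_row value_row)).
  by rewrite -[in RHS](size_enum_ord (agents I)); elim: (enum _) => //= ? ? ->.
move=> i; congr rcons; rewrite /value_row -map_comp; congr flatten.
apply: eq_map => g /=; case: IB => same bin; rewrite (same i i0).
by rewrite -[RHS]/(rcons [:: Bit _; Slash; Bit true] Comma) -encode_rat_bin;
  case: (bin i0 g) => ->.
Qed.

End IdenticalBinary.

(** * Instances realising a given row and number of agents *)

Section RowInstance.
Variables (row : seq bool) (s : seq nat).
Hypotheses (row0 : (1 <= size row)%N) (s2 : (2 <= size s)%N).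

Definition row_utility (_ : 'I_(size s)) (B : {set 'I_(size row)}) : rat :=
  (\sum_(g in B) (nth false row g)%:R)%R.

Lemma row_utility_ge0 i B : (0 <= row_utility i B)%R.
Proof. by apply: sumr_ge0 => g _; apply: ler0n. Qed.

Lemma row_utility1 i g : row_utility i [set g] = (nth false row g)%:R%R.
Proof. by rewrite /row_utility big_set1. Qed.

Lemma row_utility_additive i B :
  row_utility i B = (\sum_(g in B) row_utility i [set g])%R.
Proof. by apply: eq_bigr => g _; rewrite row_utility1. Qed.

Definition row_instance : instance rat :=
  Instance s2 row0 row_utility_ge0 row_utility_additive.

Lemma row_instance_identical_binary : identical_binary row_instance.
Proof.
split=> // i g; rewrite /= row_utility1.
by case: nth; [right | left].
Qed.

Lemma value_row_instance i : @value_row row_instance i = row.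
Proof.
rewrite /value_row /= -[RHS](mkseq_nth false) /mkseq -val_enum_ord -map_comp.
by apply: eq_map => g; rewrite /= row_utility1; case: nth.
Qed.

End RowInstance.

Lemma nth_enum_ord_map (s : seq nat) :
  [seq nth 0%N s i | i : 'I_(size s) <- enum 'I_(size s)] = s.
Proof. by rewrite -[RHS](mkseq_nth 0%N) /mkseq -val_enum_ord -map_comp. Qed.

Lemma Reformability_decide w : decide [::] w <-> Reformability identical_binary w.
Proof.
split=> [/decideP[row [s [row0 s2 -> sums bal]]]|[I [s [IB ss -> ref]]]].
  have rowP : (1 <= size row)%N by case: (row) row0.
  pose J := row_instance rowP s2; pose i0 : 'I_(agents J) := Ordinal (ltnW s2).
  have JB : identical_binary J by apply: row_instance_identical_binary.
  have sJ : is_size_vector (I := J) (fun i => nth 0%N s i).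
    by rewrite /is_size_vector /= -[size row]sums sumnE (big_nth 0%N) big_mkord.
  exists J, (fun i => nth 0%N s i); split=> //.
    by rewrite (encodeE i0 JB) value_row_instance nth_enum_ord_map.
  apply/(reformable_balanced i0 JB sJ).
  by rewrite -count_value_row value_row_instance nth_enum_ord_map.
have i0 : 'I_(agents I) := Ordinal (ltnW (agents_ge2 I)).
have size_s : size [seq s i | i <- enum 'I_(agents I)] = agents I.
  by rewrite size_map size_enum_ord.
apply/decideP; exists (value_row i0), [seq s i | i <- enum 'I_(agents I)].
split; rewrite ?size_s.
- by rewrite -size_eq0 size_map size_enum_ord -lt0n; apply: goods_ge1.
- exact: agents_ge2.
- exact: encodeE.
- by rewrite sumnE big_map big_enum size_map size_enum_ord; apply: ss.
by rewrite count_value_row; apply/reformable_balanced.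
Qed.

Theorem theorem3p10 : in_P (Reformability identical_binary).
Proof.
exists reform_tm, 100%N, 2%N => w; exists (decide [::] w).
  exact: halts_decide.
exact: Reformability_decide.
Qed.
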